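(* The polynomial $P_{10}(x)$ has non-real roots. Consequently the polynomial $$Q_{10}(z) = \sum_{\lambda \vdash 10} \ \prod_{h \in \mathcal{H}(\lambda)} \left( \frac{h^2+z}{h^2} \right) = P_{10}(z+1)$$ does not have only real roots.
   Context: The polynomials $P_n(x)$, $n \ge 0$, are defined by the formal power series identity $\sum_{n=0}^{\infty} P_n(x)\, q^n = \prod_{m=1}^{\infty} (1-q^m)^{-x}$; equivalently $P_0(x) = 1$ and $P_n(x) = \frac{x}{n} \sum_{k=1}^{n} \sigma(k) P_{n-k}(x)$ for $n \geq 1$, with $\sigma(k) = \sum_{d \mid k} d$. A partition $\lambda \vdash n$ is a finite weakly decreasing sequence of positive integers with sum $n$, represented by its Young diagram (left-justified rows, the $i$-th row from the top having $\lambda_i$ cells). For a cell $u$, the hook length is $a_u + \ell_u + 1$, where $a_u$ is the number of cells in the same row strictly to the right of $u$ and $\ell_u$ is the number of cells in the same column strictly below $u$. $\mathcal{H}(\lambda)$ is the multiset of the hook lengths of all cells of $\lambda$; products over it are taken with multiplicity. *)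

(* Defs.v *)
From HB Require Import structures.
From mathcomp Require Import all_boot all_order all_algebra.
From mathcomp Require Import reals complex.

Set Implicit Arguments.
Unset Strict Implicit.
Unset Printing Implicit Defensive.

Import Order.TTheory GRing.Theory Num.Theory.

Local Open Scope ring_scope.

Definition sigma (k : nat) : nat := (\sum_(d <- divisors k) d)%N.

(* The coefficients of \prod_(m >= 1) (1 - q^m)^(-x), given by the recurrence
   obtained from the logarithmic derivative of this product; see Ppoly0 and
   PpolyE. [Ppolys n] lists P_0, ..., P_n. *)
Fixpoint Ppolys (n : nat) : seq {poly rat} :=
  if n is m.+1 then
    let s := Ppolys m in
    rcons s (m.+1%:R^-1 *:
      ('X * \sum_(1 <= k < m.+2) (sigma k)%:R *: s`_(m.+1 - k)))
  else [:: 1].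

Definition Ppoly (n : nat) : {poly rat} := (Ppolys n)`_n.

Lemma size_Ppolys n : size (Ppolys n) = n.+1.
Proof. by elim: n => //= n IHn; rewrite size_rcons IHn. Qed.

Lemma nth_Ppolys n i : (i <= n)%N -> (Ppolys n)`_i = Ppoly i.
Proof.
elim: n => [|n IHn]; first by rewrite leqn0 => /eqP ->.
rewrite leq_eqVlt ltnS => /orP[/eqP -> // | le_in].
by rewrite /= nth_rcons size_Ppolys ltnS le_in IHn.
Qed.

Lemma Ppoly0 : Ppoly 0 = 1.
Proof. by []. Qed.

Lemma PpolyE n : (0 < n)%N ->
  Ppoly n = n%:R^-1 *:
    ('X * \sum_(1 <= k < n.+1) (sigma k)%:R *: Ppoly (n - k)).
Proof.
case: n => // n _; rewrite {1}/Ppoly /= nth_rcons size_Ppolys ltnn eqxx.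
congr (_ *: (_ * _)); apply: eq_big_nat => -[//|k] _.
by rewrite nth_Ppolys // subSS leq_subr.
Qed.

Definition is_part (la : seq nat) : bool := sorted geq la && (0%N \notin la).

Record intpart (n : nat) := IntPart {
  parts :> seq nat;
  _ : is_part parts && (sumn parts == n)
}.

HB.instance Definition _ n := [isSub for @parts n].
HB.instance Definition _ n := [Countable of intpart n by <:].

(* The partitions of n with all parts at most k, provided n <= f. *)
Fixpoint parts_le (f k n : nat) : seq (seq nat) :=
  if n == 0%N then [:: [::]] else
  if f is g.+1 then
    [seq i :: la | i <- iota 1 (minn k n), la <- parts_le g i (n - i)]
  else [::].

Lemma parts_le_uniq f k n : uniq (parts_le f k n).
Proof.
elim: f k n => [|f IHf] k n /=; case: eqP => // _.
apply: allpairs_uniq_dep => [|i _|]; rewrite ?iota_uniq //.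
by case=> [i s] [j t] _ _ [-> ->].
Qed.

Lemma mem_parts_le f k n la : (n <= f)%N ->
  (la \in parts_le f k n) =
  [&& is_part la, sumn la == n & (head 0 la <= k)%N].
Proof.
elim: f k n la => [|f IHf] k n la le_nf.
  move: le_nf; rewrite leqn0 => /eqP -> /=; rewrite inE.
  case: la => //= i la; apply/esym/negP => /and3P[/andP[_]].
  by rewrite inE addn_eq0; case: i.
rewrite /=; case: eqP => [->|/eqP n_neq0].
  rewrite inE; case: la => //= i la; apply/esym/negP => /and3P[/andP[_]].
  by rewrite inE addn_eq0; case: i.
have part_cons i s : is_part (i :: s) =
    [&& (0 < i)%N, is_part s & (head 0 s <= i)%N].
  rewrite /is_part /= inE negb_or eq_sym -lt0n.
  case: s => [|j s] /=; first by rewrite !andbT.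
  by rewrite /geq /=; case: (0 < i)%N; case: (j <= i)%N; rewrite ?andbF ?andbT.
apply/allpairsPdep/idP => [[i [s [i_in s_in ->]]]|].
  move: i_in; rewrite mem_iota add1n ltnS leq_min => /and3P[i_gt0 le_ik le_in].
  move: s_in; rewrite IHf; last first.
    by rewrite leq_subLR (leq_trans le_nf) // -add1n leq_add2r.
  case/and3P=> s_part /eqP s_sum s_head.
  by rewrite part_cons i_gt0 s_part s_head /= s_sum subnKC ?eqxx.
case: la => [|i s]; first by rewrite /= eq_sym (negbTE n_neq0).
rewrite part_cons /= => /and3P[/and3P[i_gt0 s_part s_head] /eqP s_sum le_ik].
exists i, s; split=> //.
  by rewrite mem_iota add1n ltnS leq_min i_gt0 le_ik -s_sum leq_addr.
rewrite IHf; first by rewrite s_part s_head -s_sum addKn eqxx.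
by rewrite leq_subLR (leq_trans le_nf) // -add1n leq_add2r.
Qed.

Definition enum_intpart n : seq (intpart n) := pmap insub (parts_le n n n).

Lemma enum_intpartP n : Finite.axiom (enum_intpart n).
Proof.
apply: Finite.uniq_enumP => [|la]; first exact/pmap_sub_uniq/parts_le_uniq.
rewrite mem_pmap_sub mem_parts_le //= [RHS]inE.
case: la => s /= /andP[-> /eqP <-]; rewrite eqxx.
by case: s => //= i s; rewrite leq_addr.
Qed.

HB.instance Definition _ n := isFinite.Build (intpart n) (@enum_intpartP n).

(* Cells are pairs (row, column), numbered from 0, rows from top to bottom. *)
Definition cells (la : seq nat) : seq (nat * nat) :=
  [seq (i, j) | i <- iota 0 (size la), j <- iota 0 (nth 0%N la i)].

Definition arm (la : seq nat) (u : nat * nat) : nat :=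
  count (fun v => (v.1 == u.1) && (u.2 < v.2)%N) (cells la).

Definition leg (la : seq nat) (u : nat * nat) : nat :=
  count (fun v => (v.2 == u.2) && (u.1 < v.1)%N) (cells la).

Definition hook (la : seq nat) (u : nat * nat) : nat :=
  (arm la u + leg la u + 1)%N.

Definition hooks (la : seq nat) : seq nat := [seq hook la u | u <- cells la].

Definition Qpoly (n : nat) : {poly rat} :=
  \sum_(la : intpart n) \prod_(h <- hooks la)
    ((h ^ 2)%:R^-1 *: ((h ^ 2)%:R%:P + 'X)).

(* Main.v *)
Require Import Defs.
From mathcomp Require Import all_boot all_order all_algebra.
From mathcomp Require Import reals complex.
From Stdlib Require Import QArith.
From mathcomp.algebra_tactics Require Import common.
From mathcomp Require Import ssrZ ring.

Import Order.TTheory GRing.Theory Num.Theory.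

Local Open Scope ring_scope.

(** A polynomial p whose roots are all real satisfies Laguerre's inequality
    p'(x)^2 - p(x) p''(x) >= 0 at every real x: where p(x) is nonzero, the left
    side is p(x)^2 times the sum of the 1 / (x - r)^2 over the roots r.  The
    roots of P_10 include the conjugate pair -5.46 +- 0.71 i (approximately),
    which lies so close to the real axis that the inequality already fails at
    the integer x = -5.  In terms of the coefficients c_0, c_1, c_2 of the
    translate P_10(X - 5), the failure reads c_1^2 < 2 c_0 c_2, and
    [nonreal_root] deduces a non-real root of this translate, hence one of P_10.

    The identity Q_10 = P_10(X + 1) is an equality between two explicit
    polynomials, and so is checked by computation over the 42 partitions of 10.
    It is an instance of the Nekrasov-Okounkov hook length formula.  A non-real
    root z of P_10 then gives the non-real root z - 1 of Q_10.

    Since the polynomials and rationals of the statement do not reduce, both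
    computations run on lists of fractions of binary integers that mirror the
    definitions of P_n and Q_n; [PpolyQE] and [QpolyQE] say that these lists hold the right
    coefficients. *)

(** This is Laguerre's inequality at 0.  The induction adds one root at a time:
    passing from q to (X - r) q, the quantity D = q_1^2 - 2 q_0 q_2 becomes
    q_0^2 + r^2 D.  The first two coefficients are shown real along with it, so
    that their squares are nonnegative. *)
Lemma coef_ineq_real_roots (F : numDomainType) (rs : seq F) :
  all (mem Num.real) rs ->
  let p := \prod_(r <- rs) ('X - r%:P) in
  [/\ p`_0 \is Num.real, p`_1 \is Num.real &
      2 * p`_0 * p`_2 <= p`_1 ^+ 2].
Proof.
elim: rs => [_|r rs IHrs /= /andP[r_in /IHrs[]]].
  by rewrite big_nil /= !coef1 mulr0 expr0n real0 real1.
have {r_in}r_real : r \is Num.real by exact: r_in.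
rewrite big_cons; set q := \prod_(_ <- rs) _ => q0_real q1_real le_q.
rewrite mulrBl !coefB !coefXM !coefCM /= sub0r.
split; rewrite ?rpredN ?rpredB ?rpredM //.
rewrite -subr_ge0.
rewrite (_ : _ - _ = q`_0 ^+ 2 + r ^+ 2 * (q`_1 ^+ 2 - 2 * q`_0 * q`_2)).
  apply: addr_ge0; first exact: real_exprn_even_ge0.
  by apply: mulr_ge0; [exact: real_exprn_even_ge0 | rewrite subr_ge0].
by ring.
Qed.

(** Splitting p into linear factors over the closed field, p is a real constant
    times a product to which [coef_ineq_real_roots] would apply if all the roots
    were real. *)
Lemma nonreal_root (C : numClosedFieldType) (p : {poly rat}) :
  p`_1 ^+ 2 < 2 * p`_0 * p`_2 ->
  exists z : C, root (map_poly ratr p) z /\ z \isn't Num.real.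
Proof.
move=> lt_p; have [rs Dp] := closed_field_poly_normal (map_poly (@ratr C) p).
set c := lead_coef _ in Dp.
have c_real : c \is Num.real by rewrite /c lead_coef_map realE ler0q lerq0 le_total.
have c_neq0 : c != 0.
  rewrite /c lead_coef_map fmorph_eq0 lead_coef_eq0.
  by apply: contraTneq lt_p => ->; rewrite !coef0 mulr0 expr0n ltxx.
have [rs_real|/allPn[z z_in z_nreal]] := boolP (all (mem Num.real) rs).
  have [_ _] := @coef_ineq_real_roots _ rs rs_real.
  set q := \prod_(_ <- rs) _ in Dp * => le_q.
  have Eq i : ratr p`_i = c * q`_i by rewrite -coef_map Dp coefZ.
  (* The real factor c is squared, so its sign does not matter. *)
  have c2_gt0 : 0 < c ^+ 2 by rewrite real_exprn_even_gt0.
  have: 2 * ratr p`_0 * ratr p`_2 <= ratr p`_1 ^+ 2 :> C.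
    have -> : 2 * ratr p`_0 * ratr p`_2 = c ^+ 2 * (2 * q`_0 * q`_2) :> C.
      by rewrite !Eq; ring.
    by rewrite Eq exprMn ler_pM2l.
  by rewrite -rmorphXn -(rmorph_nat (@ratr C) 2) -!rmorphM ler_rat leNgt lt_p.
exists z; split=> //.
by rewrite Dp rootZ // root_prod_XsubC.
Qed.

(* Fractions are kept reduced in the lists below: this bounds their size, and
   makes equal polynomials syntactically equal.  Symbolic simplification must
   not unfold the reduction. *)
Arguments Qred : simpl never.

Definition natQ (n : nat) : Q := inject_Z (Z.of_nat n).

Fixpoint addQs (s t : seq Q) : seq Q :=
  match s, t with
  | a :: s', b :: t' => Qred (a + b) :: addQs s' t'
  | [::], _ => t
  | _, [::] => s
  end.

Definition scaleQs (c : Q) (s : seq Q) : seq Q := [seq Qred (c * a) | a <- s].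

Arguments scaleQs : simpl never.

Definition sumQs (ss : seq (seq Q)) : seq Q := foldr addQs [::] ss.

Arguments sumQs : simpl never.

(** Horner's rule for p(X + c): if p = a + X q, then
    p(X + c) = (a + X q(X + c)) + c q(X + c). *)
Fixpoint translateQs (c : Q) (s : seq Q) : seq Q :=
  if s is a :: s' then
    let t := translateQs c s' in addQs (a :: t) (scaleQs c t)
  else [::].

(** The polynomial P_(m+1), given the list s of P_0, ..., P_m.  The divisor sum is
    written with [sumn] because the big operator in [sigma] does not reduce. *)
Definition next_PpolyQ (m : nat) (s : seq (seq Q)) : seq Q :=
  scaleQs (Qinv (natQ m.+1)) (0%Q ::
    sumQs [seq scaleQs (natQ (sumn (divisors k))) (nth [::] s (m.+1 - k))
          | k <- index_iota 1 m.+2]).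

Fixpoint PpolysQ (n : nat) : seq (seq Q) :=
  if n is m.+1 then
    let s := PpolysQ m in rcons s (next_PpolyQ m s)
  else [:: [:: 1%Q]].

Definition hookQs (hs : seq nat) : seq Q :=
  foldr (fun h s => scaleQs (Qinv (natQ (h ^ 2)))
                      (addQs (scaleQs (natQ (h ^ 2)) s) (0%Q :: s)))
        [:: 1%Q] hs.

Definition QpolyQ (n : nat) : seq Q :=
  sumQs [seq hookQs (hooks la) | la <- parts_le n n n].

Definition polyQ (s : seq Q) : {poly rat} := Poly (map R_of_Q s).

Lemma R_of_Q_red (F : realFieldType) (a : Q) : R_of_Q (Qred a) = R_of_Q a :> F.
Proof. by apply/eqP; rewrite -R_of_Q_eq; apply/Qeq_bool_iff/Qred_correct. Qed.

Lemma R_of_natQ (F : realFieldType) n : R_of_Q (natQ n) = n%:R :> F.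
Proof. by rewrite /R_of_Q /= divr1 -[Z.of_nat n]/(Z_of_int n) Z_of_intK. Qed.

Lemma R_of_inv_natQ (F : realFieldType) n : R_of_Q (Qinv (natQ n)) = n%:R^-1 :> F.
Proof.
(* Both inverses of 0 are 0 by convention. *)
have [->|n_gt0] := posnP n; first by rewrite invr0 /R_of_Q mul0r.
apply: (@mulfI _ n%:R); first by rewrite pnatr_eq0 -lt0n.
rewrite mulfV ?pnatr_eq0 -?lt0n // -{1}R_of_natQ -R_of_Q_mul -(R_of_Q1 F).
apply/eqP; rewrite -R_of_Q_eq; apply/Qeq_bool_iff/Qmult_inv_r.
by case: n n_gt0.
Qed.

Lemma coef_polyQ s i : (polyQ s)`_i = R_of_Q (nth 0%Q s i).
Proof.
rewrite coef_Poly; have [lt_is|le_si] := ltnP i (size s).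
  by rewrite (nth_map 0%Q).
by rewrite !nth_default ?size_map // R_of_Q0.
Qed.

Lemma polyQ_cons a s : polyQ (a :: s) = (R_of_Q a)%:P + 'X * polyQ s.
Proof. by rewrite /polyQ /= cons_poly_def addrC mulrC. Qed.

Lemma polyQ_add s t : polyQ (addQs s t) = polyQ s + polyQ t.
Proof.
elim: s t => [|a s IHs] [|b t]; rewrite /= ?[polyQ [::]]/(0 : {poly rat}) ?add0r ?addr0 //.
by rewrite !polyQ_cons IHs R_of_Q_red R_of_Q_add polyCD mulrDr addrACA.
Qed.

Lemma polyQ_scale c s : polyQ (scaleQs c s) = R_of_Q c *: polyQ s.
Proof.
elim: s => [|a s IHs]; first by rewrite scaler0.
rewrite /scaleQs map_cons -/(scaleQs c s) !polyQ_cons IHs R_of_Q_red R_of_Q_mul scalerDr polyCM mul_polyC.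
by rewrite scalerAr.
Qed.

Lemma polyQ_sum ss : polyQ (sumQs ss) = \sum_(s <- ss) polyQ s.
Proof.
elim: ss => [|s ss IHss]; first by rewrite big_nil.
by rewrite big_cons -IHss -polyQ_add.
Qed.

Lemma polyQ_translate c s :
  polyQ (translateQs c s) = polyQ s \Po ('X + (R_of_Q c)%:P).
Proof.
elim: s => [|a s IHs]; first by rewrite /= comp_poly0.
rewrite -[translateQs _ _]/(let t := translateQs c s in addQs (a :: t) (scaleQs c t)).
rewrite polyQ_add !polyQ_cons polyQ_scale IHs.
by rewrite comp_polyD comp_polyC comp_polyM comp_polyX mulrDl mul_polyC addrA.
Qed.

Lemma PpolysQE n : Ppolys n = map polyQ (PpolysQ n).
Proof.
elim: n => [|n IHn] /=.
  by rewrite polyQ_cons mulr0 addr0 R_of_Q1.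
rewrite map_rcons -IHn /next_PpolyQ polyQ_scale R_of_inv_natQ polyQ_cons R_of_Q0 add0r.
congr (rcons _ (_ *: (_ * _))).
rewrite polyQ_sum big_map; apply: eq_bigr => k _.
rewrite polyQ_scale R_of_natQ sumnE IHn; congr (_ *: _).
have [lt_i|le_i] := ltnP (n.+1 - k) (size (PpolysQ n)).
  by rewrite (nth_map [::]).
by rewrite !nth_default ?size_map.
Qed.

Lemma PpolyQE n : Ppoly n = polyQ (nth [::] (PpolysQ n) n).
Proof.
rewrite /Ppoly PpolysQE (nth_map [::]) //.
by rewrite -(size_map polyQ) -PpolysQE size_Ppolys.
Qed.

(** This turns the sum over the finite type of partitions into a sum over the
    computable list of their parts. *)
Lemma perm_parts n :
  perm_eq (map (@parts n) (index_enum (intpart n))) (parts_le n n n).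
Proof.
apply: uniq_perm => [||la]; last 1 first.
- rewrite mem_parts_le //; apply/mapP/and3P.
    case=> -[s /= /andP[s_part /eqP s_sum]] _ ->; split; rewrite // ?s_sum //.
    by case: s s_sum {s_part} => //= i s <-; apply: leq_addr.
  case=> la_part la_sum _.
  have la_ok : is_part la && (sumn la == n) by rewrite la_part.
  by exists (IntPart la_ok); rewrite ?mem_index_enum.
- by rewrite map_inj_uniq ?index_enum_uniq //; exact: val_inj.
- exact: parts_le_uniq.
Qed.

Lemma QpolyQE n : Qpoly n = polyQ (QpolyQ n).
Proof.
rewrite /Qpoly polyQ_sum big_map -(perm_big _ (perm_parts n)) big_map.
apply: eq_bigr => la _; elim: (hooks la) => [|h hs IHhs].
  by rewrite big_nil polyQ_cons mulr0 addr0 R_of_Q1.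
rewrite big_cons IHhs /= polyQ_scale R_of_inv_natQ polyQ_add polyQ_scale.
by rewrite polyQ_cons R_of_Q0 R_of_natQ add0r -scalerAl mulrDl mul_polyC.
Qed.

Lemma coef_ineq_fails_polyQ s :
  Qle_bool (Qmult (Qmult 2 (nth 0%Q s 0)) (nth 0%Q s 2))
           (Qmult (nth 0%Q s 1) (nth 0%Q s 1)) = false ->
  (polyQ s)`_1 ^+ 2 < 2 * (polyQ s)`_0 * (polyQ s)`_2.
Proof.
rewrite /= !coef_polyQ expr2 (R_of_Q_le rat) !R_of_Q_mul leNgt => /negbFE.
by rewrite (_ : R_of_Q 2%Q = 2) // /R_of_Q divr1.
Qed.

Theorem mainTheorem2 (R : realType) :
  (exists z : R[i],
      root (map_poly ratr (Ppoly 10)) z /\ z \isn't Num.real) /\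
  Qpoly 10 = Ppoly 10 \Po ('X + 1) /\
  ~ (forall z : R[i], root (map_poly ratr (Qpoly 10)) z -> z \is Num.real).
Proof.
have comp_root (p : {poly rat}) (c : int) (z : R[i]) :
      root (map_poly ratr (p \Po ('X + c%:~R%:P))) z =
      root (map_poly ratr p) (z + c%:~R).
  rewrite map_comp_poly rmorphD /= map_polyX map_polyC /= ratr_int.
  by rewrite !rootE horner_comp !hornerE.
have PnR : exists z : R[i],
    root (map_poly ratr (Ppoly 10)) z /\ z \isn't Num.real.
  have [|z [pz z_nreal]] := @nonreal_root R[i] (Ppoly 10 \Po ('X + (-5)%:~R%:P)).
    rewrite (_ : _%:~R = R_of_Q (-5)%Q); last by rewrite /R_of_Q divr1.
    (* c_0 = 9, c_1 = 13267/2520 and c_2 = 39059/7200. *)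
    rewrite PpolyQE -polyQ_translate; apply: coef_ineq_fails_polyQ.
    by vm_compute.
  exists (z + (-5)%:~R); rewrite -comp_root; split=> //.
  by rewrite rpredDr // realz.
have Q_P : Qpoly 10 = Ppoly 10 \Po ('X + 1).
  rewrite -[1]/(1%:P) -(R_of_Q1 rat) PpolyQE QpolyQE -polyQ_translate.
  by congr polyQ; vm_compute.
split=> //; split=> // all_real; have [z [pz /negP[]]] := PnR.
rewrite -(subrK 1 z) rpredD ?real1 //; apply: all_real.
by rewrite Q_P -[1]/(1%:~R%:P) comp_root subrK.
Qed.
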